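(* Let $p(x)=\sum_{j=0}^m a_jx^j$ be a real polynomial of degree $m$ with $a_j\ge 0$ for all $j$, and for $k\ge 0$ let $S(k)=\sum_{j=0}^k p(j)$. If $1\le \ell\le m+1$ is an integer and the sequence $\left\{\frac{S(k)}{(k+1)_\ell}\right\}_{k=0}^\infty$ is a multiplier sequence, then so is the sequence $$\{0,0,\ldots,0,p(0),p(1),p(2),\ldots\},$$ in which $p(0)$ occupies the $\ell$-th slot (i.e., $p(0)$ is preceded by exactly $\ell-1$ zeros).
   Context: $(b)_\ell=b(b+1)\cdots(b+\ell-1)$ denotes the rising factorial, so $(k+1)_\ell=(k+1)(k+2)\cdots(k+\ell)$. A sequence of real numbers $\{\gamma_k\}_{k=0}^\infty$ is a multiplier sequence if the linear operator $T$ on real polynomials defined by $T[x^k]=\gamma_kx^k$, $k=0,1,2,\ldots$, has the property that $T[p]$ has no non-real zeros whenever the real polynomial $p$ has no non-real zeros (the zero polynomial is regarded as having no non-real zeros). *)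

(* Defs.v *)
(* [R : realType] is an arbitrary model of the real numbers; the complex numbers
   are [R[i]]. *)
From HB Require Import structures.
From mathcomp Require Import all_boot all_order all_algebra.
From mathcomp Require Import reals.
From mathcomp.real_closed Require Import complex.

Set Implicit Arguments.
Unset Strict Implicit.
Unset Printing Implicit Defensive.

Import Order.TTheory GRing.Theory Num.Theory.
Local Open Scope ring_scope.

(* [p = 0] is a separate case: every complex number is a root of the zero
   polynomial, which nevertheless counts as having no non-real zeros. *)
Definition no_nonreal_zeros (R : realType) (p : {poly R}) : Prop :=
  p = 0 \/
  forall z : R[i], root (map_poly (real_complex R) p) z -> z \is Num.real.

Definition diag_op (R : realType) (gamma : nat -> R) (p : {poly R}) : {poly R} :=
  \poly_(k < size p) (gamma k * p`_k).

(* [diag_op_is_linear] and [diag_opXn] characterize [diag_op gamma] as the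
   linear operator with 'X^k |-> gamma k *: 'X^k. *)
Lemma coef_diag_op (R : realType) (gamma : nat -> R) (p : {poly R}) k :
  (diag_op gamma p)`_k = gamma k * p`_k.
Proof.
by rewrite coef_poly; case: ltnP => // ?; rewrite nth_default // mulr0.
Qed.

Lemma diag_op_is_linear (R : realType) (gamma : nat -> R) :
  linear (diag_op gamma).
Proof.
move=> a p q; apply/polyP => k.
by rewrite !(coef_diag_op, coefD, coefZ) mulrDr mulrCA.
Qed.

HB.instance Definition _ (R : realType) (gamma : nat -> R) :=
  GRing.isLinear.Build R {poly R} {poly R} _ (diag_op gamma)
    (diag_op_is_linear gamma).

Lemma diag_opXn (R : realType) (gamma : nat -> R) k :
  diag_op gamma 'X^k = gamma k *: 'X^k.
Proof.
apply/polyP => i; rewrite coef_diag_op coefZ coefXn.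
by case: eqP => [->|_] //; rewrite !mulr0.
Qed.

Definition multiplier_sequence (R : realType) (gamma : nat -> R) : Prop :=
  forall p : {poly R}, no_nonreal_zeros p -> no_nonreal_zeros (diag_op gamma p).

Definition rising_fact (R : realType) (b : R) (l : nat) : R :=
  \prod_(i < l) (b + i%:R).

Definition partial_sum (R : realType) (p : {poly R}) (k : nat) : R :=
  \sum_(j < k.+1) p.[j%:R].

(* The sequence 0, ..., 0, u 0, u 1, u 2, ... with [n] leading zeros. *)
Definition shift_seq (R : realType) (n : nat) (u : nat -> R) (k : nat) : R :=
  if (k < n)%N then 0 else u (k - n)%N.

(* Main.v *)
Require Import Defs.
From mathcomp Require Import all_boot all_order all_algebra.
From mathcomp Require Import reals.
From mathcomp Require Import ring lra.
From mathcomp.real_closed Require Import complex polyrcf.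

Import Order.TTheory GRing.Theory Num.Theory.
Local Open Scope ring_scope.
Local Open Scope complex_scope.

(** Let S be the sequence of partial sums, T the operator of the target
    sequence, and W r the polynomial obtained from the l-th derivative of r by
    applying the operator of S(k) / (k+1)_l.  The falling factorials produced by
    the derivatives cancel the denominators, so the coefficient of X^i in W r is
    S(i) r_(l+i).  By the Gauss-Lucas theorem and the hypothesis, W preserves
    real-rootedness.  Because S(i) - S(i-1) = p(i), the operator T is, up to
    a power of X, the commutator of W with multiplication by X:
      T q = X^(l-1) (A - X B),   A = W (X q),   B = W q.
    For every real a the polynomial A - a B = W ((X - a) q) is real-rooted, and
    the theorem reduces to replacing the constant a by the variable X
    ([pencil_sub_mulX]); this is immediate if B = 0.

    Real-rootedness of the pencil says that A / B takes no real value in the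
    open upper half-plane.  Suppose that A - X B vanishes at a point z of that
    half-plane.  Then A / B has the value z at z, hence by connectedness maps
    the half-plane into itself ([pick_quotient_sign]).  A rational function with
    this property has the form
      alpha X + beta - sum_b c_b / (X - b),   c_b >= 0,
    so its imaginary part at z is at least alpha Im z.  Here alpha >= 1, because
    the coefficient of A - X B in degree 1 + deg B is a value of p times the
    coefficient of q occurring in the leading coefficient of B.  A fixed point
    therefore forces alpha = 1 and all c_b = 0, and A - X B = beta B, which is
    real-rooted (or zero).

    The argument about residues is carried out polynomially.  Local analysis
    near a root b of B shows that A vanishes at b if b is a multiple root
    ([pick_quotient_multiple_root]), in which case X - b can be divided out, and
    that A(b) B'(b) <= 0 if b is simple ([pick_quotient_simple_root]).  In the
    simple case A - X B = Q H with Q the real quadratic factor vanishing at z;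
    then H(b) B'(b) <= 0 at all roots b of B, while Lagrange interpolation
    expresses the coefficient of H in degree deg B - 1, which is nonnegative if B
    is monic, as the sum of the H(b) / B'(b); so H = 0 ([interpolation_le0_eq0]). *)

Section RealRootedPencils.
Variable R : realType.
Implicit Types (p q A B : {poly R}) (z w s : R[i]) (P : {poly R[i]}).

Local Notation Im := (@complex.Im R).
Local Notation cpoly := (map_poly (real_complex R)).

(** * Imaginary parts of complex polynomials on the real line *)

Lemma horner_conj p z : (cpoly p).[conjc z] = conjc (cpoly p).[z].
Proof.
have -> : (cpoly p).[conjc z] = (map_poly conjc (cpoly p)).[conjc z].
  by rewrite -map_poly_comp; congr (_.[_]); apply: eq_map_poly => x /=; rewrite oppr0.
by rewrite horner_map.
Qed.

Lemma Im_sum (I : Type) (r : seq I) (F : I -> R[i]) :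
  Im (\sum_(i <- r) F i) = \sum_(i <- r) Im (F i).
Proof. by apply: (big_morph Im) => // -[? ?] [? ?]. Qed.

Lemma horner_map_Im P (t : R) : (map_poly Im P).[t] = Im P.[t%:C].
Proof.
rewrite (@horner_coef_wide _ (size P)) ?size_poly // horner_coef.
rewrite Im_sum; apply: eq_bigr => i _; rewrite coef_map_id0 // -rmorphXn /=.
by case: (P`_i) => a b /=; rewrite mulr0 add0r.
Qed.

(** The intermediate value theorem for the real polynomial t |-> Im P(t).  All
    connectedness arguments below run along segments and reduce to this. *)
Lemma Im_sign_segment P :
  (forall t : R, 0 <= t <= 1 -> Im P.[t%:C] != 0) ->
  0 < Im P.[0] -> 0 < Im P.[1].
Proof.
move=> P_n0 P0; rewrite ltNge; apply/negP => P1.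
have [||t] := @polyrcf.poly_ivt _ (map_poly Im P) 0 1 => //.
  by rewrite !horner_map_Im rmorph0 rmorph1 pmulr_rle0.
by rewrite in_itv /= => /P_n0; rewrite rootE horner_map_Im => /negPf->.
Qed.

Lemma Im_ge0_limit P :
  (forall t : R, 0 < t -> 0 <= Im P.[t%:C]) -> 0 <= Im P.[0].
Proof.
move=> P_ge0; rewrite leNgt; apply/negP => P0.
have [|d d0 dP] := @poly_cont _ 0 (map_poly Im P) (- Im P.[0]).
  by rewrite oppr_gt0.
have d2 : 0 < d / 2 by rewrite divr_gt0.
have := dP (d / 2); rewrite subr0 !horner_map_Im rmorph0 gtr0_norm //.
have := P_ge0 _ d2; move: (Im _) => x x0 /(_ _).
rewrite ltr_pdivrMr // ltr_pMr // ltr1n => /(_ isT); rewrite ltr_norml; lra.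
Qed.

(** * Real-rooted polynomials and the Gauss-Lucas theorem *)

Lemma real_rooted_mul p q :
  no_nonreal_zeros p -> no_nonreal_zeros q -> no_nonreal_zeros (p * q).
Proof.
move=> [->|Hp] [->|Hq]; rewrite ?mulr0 ?mul0r; try by left.
by right=> z; rewrite rmorphM rootM => /orP [/Hp|/Hq].
Qed.

Lemma real_rooted1 : no_nonreal_zeros (1 : {poly R}).
Proof. by right=> z; rewrite rmorph1 rootE hornerC oner_eq0. Qed.

Lemma real_rooted_XsubC (a : R) : no_nonreal_zeros ('X - a%:P).
Proof.
right=> z; rewrite rmorphB /= map_polyX map_polyC root_XsubC => /eqP->.
by apply/complex_realP; exists a.
Qed.

(** Nonreal zeros of a real polynomial come in conjugate pairs, so the open upper
    half-plane sees all of them. *)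
Lemma real_rootedP p :
  p = 0 \/ (forall z, 0 < Im z -> (cpoly p).[z] != 0) <-> no_nonreal_zeros p.
Proof.
split=> -[p0|H]; [by left| |by left|].
  right=> -[x y]; rewrite complex_real => pz.
  have [y0|y0|//] := ltrgtP y 0; last by have := H (x +i* y) y0; rewrite -rootE pz.
  have := H (conjc (x +i* y)); rewrite horner_conj conjc_eq0 -rootE pz /= oppr_gt0.
  by move=> /(_ y0).
right=> -[x y] y0; apply/negP => pz; have := H (x +i* y) pz.
by rewrite complex_real => /eqP yE; move: y0; rewrite /= yE ltxx.
Qed.

Lemma real_rooted_factor p : p != 0 -> no_nonreal_zeros p ->
  exists bs : seq R, p = lead_coef p *: \prod_(b <- bs) ('X - b%:P).
Proof.
move=> p0 [/eqP|H]; first by rewrite (negPf p0).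
have [rs rsE] := closed_field_poly_normal (cpoly p).
rewrite lead_coef_map in rsE.
have rs_real z : z \in rs -> z = (complex.Re z)%:C.
  move=> zrs; rewrite RRe_real //; apply: H.
  by rewrite rsE rootZ ?root_prod_XsubC // fmorph_eq0 lead_coef_eq0.
exists (map (@complex.Re R) rs); apply: (map_poly_inj (real_complex R)).
rewrite rsE map_polyZ /= rmorph_prod big_map; congr (_ *: _).
apply: eq_big_seq => z /rs_real {1}->.
by rewrite rmorphB /= map_polyX map_polyC.
Qed.

(** The Gauss-Lucas theorem for real zeros: p'/p is the sum of the 1 / (X - b),
    each of which has negative imaginary part at z.  Multiplying p'(z) by the
    conjugate of p(z) instead of dividing keeps the statement polynomial. *)
Lemma Im_deriv_prod (bs : seq R) z (p := \prod_(b <- bs) ('X - b%:P)) :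
  0 < Im z ->
  Im ((cpoly p^`()).[z] * conjc (cpoly p).[z]) <= 0 /\
  (~~ nilp bs -> Im ((cpoly p^`()).[z] * conjc (cpoly p).[z]) < 0).
Proof.
move=> z0; rewrite /p {p}; elim: bs => [|b bs [IH _]].
  by rewrite big_nil derivC rmorph0 horner0 mul0r.
rewrite big_cons; set q := \prod_(_ <- _) _ in IH *.
have q_n0 : (cpoly q).[z] != 0.
  have /real_rootedP [q0|->//] : no_nonreal_zeros q.
    rewrite /q; elim/big_rec: _ => [|c r _]; first exact: real_rooted1.
    exact/real_rooted_mul/real_rooted_XsubC.
  have := monic_prod_XsubC bs xpredT id.
  by rewrite -/q q0 monicE lead_coef0 eq_sym oner_eq0.
rewrite derivM derivXsubC mul1r rmorphD !rmorphM rmorphB /= map_polyX map_polyC.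
rewrite !(hornerE, hornerM) /=.
move: ((cpoly q).[z]) ((cpoly q^`()).[z]) q_n0 IH => [u v] [u' v'] /=.
rewrite eq_complex /= negb_and => uv_n0.
case: z z0 => x y /= y0.
set d := _ + _ => d_le0.
suff H : forall e, e = - y * (u ^+ 2 + v ^+ 2) + ((x - b) ^+ 2 + y ^+ 2) * d -> e < 0.
  split=> [|_]; first apply: ltW.
    apply: H; rewrite /d; ring.
  apply: H; rewrite /d; ring.
move=> e ->; rewrite -[ltRHS](addr0 0) ltr_leD //.
  rewrite mulNr oppr_lt0 mulr_gt0 // lt0r paddr_eq0 ?sqr_ge0 // !sqrf_eq0.
  by rewrite negb_and uv_n0 addr_ge0 ?sqr_ge0.
by rewrite mulr_ge0_le0 // addr_ge0 ?sqr_ge0.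
Qed.

Lemma real_rooted_deriv p : no_nonreal_zeros p -> no_nonreal_zeros p^`().
Proof.
have [->|p0 /(real_rooted_factor p p0) [bs pE]] := eqVneq p 0.
  by rewrite derivC.
have [bs0|bs_n0] := boolP (nilp bs).
  by left; rewrite pE (nilP bs0) big_nil derivZ derivC scaler0.
apply/real_rootedP; right=> z z0; apply/negP => /eqP pz.
have [_ /(_ bs_n0)] := Im_deriv_prod bs z z0.
move: pz; rewrite {1}pE derivZ map_polyZ hornerZ => /eqP.
rewrite mulf_eq0 /= fmorph_eq0 lead_coef_eq0 (negPf p0) /= => /eqP->.
by rewrite mul0r ltxx.
Qed.

(** * Quotients mapping the upper half-plane into itself *)

(** The k-th roots of i are not real, and their sum is 0 as k >= 2; so some lie
    above the real axis and some below.  Conjugating one of the latter gives a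
    point of the upper half-plane with k-th power -i. *)
Lemma exists_pow_Im_signs k : (1 < k)%N ->
  (exists2 s, 0 < Im s & Im (s ^+ k) < 0) /\
  (exists2 s, 0 < Im s & 0 < Im (s ^+ k)).
Proof.
move=> k1.
have [rs rsE] := closed_field_poly_normal ('X^k - ('i%C : R[i])%:P).
have szP : size ('X^k - ('i%C : R[i])%:P) = k.+1 by rewrite size_XnsubC // ltnW.
have lcP : lead_coef ('X^k - ('i%C : R[i])%:P) = 1.
  by apply/eqP; rewrite -monicE monicXnsubC // ltnW.
rewrite lcP scale1r in rsE.
have szrs : size rs = k.
  by move: szP; rewrite rsE size_prod_XsubC => -[].
have sum0 : \sum_(s <- rs) s = 0.
  apply/eqP; rewrite -oppr_eq0 -coefPn_prod_XsubC; last first.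
    by rewrite szrs -lt0n ltnW.
  rewrite -rsE szrs coefB coefXn coefC; case: k k1 {szP lcP rsE szrs} => [|[|k]] //= _.
  by rewrite ltn_eqF // subr0 eqxx.
have rsP s : s \in rs -> s ^+ k = 'i%C.
  move=> srs; apply/eqP; rewrite -subr_eq0.
  have := root_prod_XsubC rs s; rewrite -rsE srs rootE.
  by rewrite !(hornerE, hornerXn).
have Im_n0 s : s \in rs -> Im s != 0.
  case: s => a b /rsP; apply: contra_eqN => /= /eqP->.
  by rewrite -[_ +i* _]/(a%:C) -rmorphXn /= eq_complex /= [_ == 1]eq_sym oner_eq0 andbF.
have sumIm : \sum_(s <- rs) Im s = 0.
  by rewrite -Im_sum sum0.
have rs_n0 : exists s, s \in rs.
  by case: (rs) szrs k1 => [<- //|s ? _ _]; exists s; rewrite mem_head.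
split.
- have [/hasP[s srs s0]|/hasPn rs_ge0] := boolP (has (fun s => Im s < 0) rs).
    exists (conjc s); first by case: s {srs} s0 => a b /=; rewrite oppr_gt0.
    by rewrite -rmorphXn /= (rsP _ srs) /= oppr_lt0 ltr01.
  have [s srs] := rs_n0; have /negP[] := Im_n0 _ srs.
  move/eqP: sumIm; rewrite big_seq psumr_eq0; last first.
    by move=> z /rs_ge0; rewrite -leNgt.
  by move=> /allP/(_ _ srs); rewrite srs.
- have [/hasP[s srs s0]|/hasPn rs_le0] := boolP (has (fun s => 0 < Im s) rs).
    by exists s; rewrite ?(rsP _ srs).
  have [s srs] := rs_n0; have /negP[] := Im_n0 _ srs.
  move/eqP: sumIm; rewrite -oppr_eq0 -sumrN big_seq psumr_eq0; last first.
    by move=> z /rs_le0; rewrite -leNgt oppr_ge0.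
  by move=> /allP/(_ _ srs); rewrite srs oppr_eq0.
Qed.

(** A / B is a Pick function (it maps the open upper half-plane into
    itself): the imaginary part of A(z) / B(z) has the sign of that of A(z) times
    the conjugate of B(z).  In particular neither A nor B vanishes there. *)
Definition pick_quotient A B := forall z, 0 < Im z ->
  0 < Im ((cpoly A).[z] * conjc (cpoly B).[z]).

(** The upper half-plane is convex: along the segment from z0 to z the imaginary
    part cannot change sign.  The conjugate of B(w) is B evaluated at the
    conjugate of w, which makes the restriction to the segment a polynomial. *)
Lemma pick_quotient_sign A B z0 :
  (forall z, 0 < Im z -> Im ((cpoly A).[z] * conjc (cpoly B).[z]) != 0) ->
  0 < Im z0 -> 0 < Im ((cpoly A).[z0] * conjc (cpoly B).[z0]) -> pick_quotient A B.
Proof.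
move=> AB_n0 z0_gt0 AB0 z z_gt0.
pose line x y : {poly R[i]} := x%:P + (y - x) *: 'X.
have lineE x y t : (line x y).[t] = x + (y - x) * t.
  by rewrite /line !(hornerE, hornerD).
pose P := (cpoly A \Po line z0 z) * (cpoly B \Po line (conjc z0) (conjc z)).
have PE (t : R) : P.[t%:C] =
    (cpoly A).[z0 + (z - z0) * t%:C] * conjc (cpoly B).[z0 + (z - z0) * t%:C].
  rewrite hornerM !horner_comp !lineE -horner_conj.
  by rewrite rmorphD rmorphM rmorphB /= oppr0.
have := PE 1; have := PE 0.
rewrite rmorph0 rmorph1 mulr0 mulr1 addr0 addrC subrK => P0 P1.
rewrite -P1; apply: Im_sign_segment => [t t01|]; last by rewrite P0.
rewrite PE; apply: AB_n0.
case: z z0 z_gt0 z0_gt0 {AB0 P P0 P1 PE line lineE} => x y [x0 y0] /= y_gt0 y0_gt0.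
nra.
Qed.

(** Near a zero b of order k of the denominator, at b + t s with t > 0 small, A
    times the conjugate of the denominator is t^k A(b) B(b) conj(s)^k up to
    higher order; divide by t^k and let t tend to 0. *)
Lemma pick_quotient_root A B b k s :
  pick_quotient A (('X - b%:P) ^+ k * B) -> 0 < Im s ->
  A.[b] * B.[b] * Im (s ^+ k) <= 0.
Proof.
move=> AB s_gt0.
pose line y : {poly R[i]} := b%:C%:P + y *: 'X.
have lineE y t : (line y).[t] = b%:C + y * t.
  by rewrite /line !(hornerE, hornerD).
pose P := (cpoly A \Po line s) * ((conjc s) ^+ k *: (cpoly B \Po line (conjc s))).
have PE (t : R) : P.[t%:C] =
    (cpoly A).[b%:C + s * t%:C] * ((conjc s) ^+ k * conjc (cpoly B).[b%:C + s * t%:C]).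
  rewrite hornerM hornerZ !horner_comp !lineE -horner_conj.
  by rewrite rmorphD rmorphM /= !oppr0.
have := @Im_ge0_limit P; rewrite -[X in P.[X]](rmorph0 (real_complex R)) PE.
rewrite rmorph0 mulr0 addr0 !horner_map /= -rmorphXn /=.
case: (s ^+ k) => x y /= H; suff /H : forall t, 0 < t -> 0 <= Im P.[t%:C].
  by rewrite oppr0; nra.
move=> t t0; rewrite PE.
have tk0 : 0 < t ^+ k by rewrite exprn_gt0.
have : 0 < Im (b%:C + s * t%:C).
  by case: (s) s_gt0 => a c /=; nra.
move=> /AB; rewrite rmorphM rmorphXn rmorphB /= map_polyX map_polyC.
rewrite !(hornerE, horner_exp) /= [b%:C + _]addrC addrK exprMn -rmorphXn /=.
move: ((cpoly A).[_]) ((cpoly B).[_]) => a c.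
rewrite !rmorphM /= -rmorphXn /= oppr0 => H1.
rewrite -(pmulr_rge0 _ tk0); apply: ltW; move: H1; congr (0 < _).
move: (conjc (s ^+ k)) (conjc c) => [? ?] [? ?]; case: a => ? ? /=; ring.
Qed.

(** In the partial fraction expansion of a Pick function, the residue at a simple
    pole is nonpositive. *)
Lemma pick_quotient_simple_root A B b :
  pick_quotient A (('X - b%:P) * B) -> A.[b] * B.[b] <= 0.
Proof.
move=> AB; have := @pick_quotient_root A B b 1 'i%C.
by rewrite !expr1 /= mulr1; apply.
Qed.

(** A Pick function has no multiple poles: near a pole of order at least 2 it would
    take values on both sides of the real axis already on a half-disc above. *)
Lemma pick_quotient_multiple_root A B b k : (1 < k)%N ->
  pick_quotient A (('X - b%:P) ^+ k * B) -> B.[b] != 0 -> A.[b] = 0.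
Proof.
move=> k1 AB B0.
have [[s s0 sk] [s' s'0 s'k]] := exists_pow_Im_signs k k1.
have := pick_quotient_root _ _ _ _ _ AB s0.
have := pick_quotient_root _ _ _ _ _ AB s'0.
rewrite (pmulr_lle0 _ s'k) (nmulr_lle0 _ sk) => AB_le0 AB_ge0.
by apply/eqP; rewrite -(mulIr_eq0 _ (mulIf B0)) eq_le AB_le0.
Qed.

Lemma pick_quotient_mulXsubC A B b :
  pick_quotient (('X - b%:P) * A) (('X - b%:P) * B) -> pick_quotient A B.
Proof.
move=> AB z z0; have := AB _ z0.
rewrite !rmorphM rmorphB /= map_polyX map_polyC !(hornerE, hornerM) /=.
rewrite rmorphM.
move: ((cpoly A).[z]) ((cpoly B).[z]) => [a1 a2] [b1 b2].
case: z z0 => x y /= y0 H.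
have d0 : 0 < (x - b) ^+ 2 + y ^+ 2.
  by rewrite ltr_wpDl ?sqr_ge0 // exprn_gt0.
rewrite -(pmulr_rgt0 _ d0); move: H; congr (0 < _); ring.
Qed.

(** * Fixed points of Pick quotients *)

(** By Lagrange interpolation the coefficient of H in degree n - 1, with n the
    number of nodes, is the sum of the H(b) / B'(b); all terms being nonpositive
    and the sum nonnegative, H vanishes at n points.  The induction peels off one
    interpolation node at a time, in the manner of Newton. *)
Lemma interpolation_le0_eq0 (bs : seq R) (H : {poly R})
    (B := \prod_(b <- bs) ('X - b%:P)) :
  uniq bs -> (size H <= size bs)%N ->
  (forall b, b \in bs -> H.[b] * B^`().[b] <= 0) ->
  0 <= H`_(size bs).-1 -> H = 0.
Proof.
rewrite /B {B}; elim: bs H => [|b bs IH] H /=.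
  by move=> _; rewrite leqn0 size_poly_eq0 => /eqP.
case/andP=> b_bs bs_uniq szH Hbs Hlead.
pose B1 := \prod_(c <- bs) ('X - c%:P).
have derB c :
    (\prod_(c <- b :: bs) ('X - c%:P))^`().[c] = B1.[c] + (c - b) * B1^`().[c].
  by rewrite big_cons derivM derivXsubC mul1r !(hornerE, hornerD).
have B1b : B1.[b] != 0 by rewrite -rootE root_prod_XsubC.
have szB1 : size B1 = (size bs).+1 by rewrite size_prod_XsubC.
have B1lead : B1`_(size bs) = 1.
  by have /monicP := monic_prod_XsubC bs xpredT id; rewrite lead_coefE szB1.
pose h := H.[b] / B1.[b].
have h_le0 : h <= 0.
  have := Hbs b (mem_head _ _); rewrite derB subrr mul0r addr0 /h.
  have B1b2 : 0 < B1.[b] ^+ 2 by rewrite exprn_even_gt0.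
  rewrite -(pmulr_lle0 (H.[b] / _) B1b2).
  by congr (_ <= 0); field.
have /factor_theorem [H1 H1E] : root (H - h *: B1) b.
  by rewrite rootE !hornerE /h divfK // subrr.
have {}H1E : H = h *: B1 + ('X - b%:P) * H1 by rewrite mulrC -H1E addrC subrK.
have szH1 : (size H1 <= size bs)%N.
  have [->|H1_0] := eqVneq H1 0; first by rewrite size_poly0.
  rewrite -ltnS; apply: leq_trans (_ : (size (H - h *: B1)%R <= _)%N).
    by rewrite {1}H1E addrAC subrr add0r size_mul ?polyXsubC_eq0 // size_XsubC.
  rewrite (leq_trans (size_polyD _ _)) // geq_max szH size_polyN.
  by rewrite (leq_trans (size_scale_leq _ _)) ?szB1.
have HleadE : H`_(size bs) = h + H1`_(size bs).-1.
  rewrite H1E coefD coefZ B1lead mulr1 mulrBl coefB coefXM coefCM.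
  rewrite [H1`_(size bs)]nth_default // mulr0 subr0.
  case: (size bs) szH1 => //=; rewrite leqn0 size_poly_eq0 => /eqP ->.
  by rewrite coef0.
have H1_0 : H1 = 0.
  apply: IH => //; last first.
    by move: Hlead; rewrite HleadE; lra.
  move=> c cbs; have := Hbs c; rewrite inE cbs orbT => /(_ isT).
  have B1c : B1.[c] = 0 by apply/eqP; rewrite -rootE root_prod_XsubC.
  rewrite derB B1c add0r H1E hornerD hornerZ hornerM hornerXsubC B1c mulr0 add0r.
  have cb : c - b != 0 by rewrite subr_eq0; apply: contraNneq b_bs => <-.
  have cb2 : 0 < (c - b) ^+ 2 by rewrite exprn_even_gt0.
  rewrite -(pmulr_rle0 (H1.[c] * _) cb2).
  by congr (_ <= 0); ring.
have h0 : h = 0.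
  apply/le_anti; rewrite h_le0 /=; move: Hlead; rewrite HleadE H1_0 coef0 addr0 //.
by rewrite H1E H1_0 h0 scale0r mulr0 addr0.
Qed.

(** The real quadratic polynomial with roots u + iv and u - iv. *)
Definition conj_factor (u v : R) : {poly R} :=
  'X^2 - (2 * u) *: 'X + (u ^+ 2 + v ^+ 2)%:P.

Lemma size_conj_factor u v : size (conj_factor u v) = 3%N.
Proof.
rewrite /conj_factor -addrA size_polyDl size_polyXn //.
rewrite (leq_ltn_trans (size_polyD _ _)) // gtn_max size_polyN.
rewrite (leq_ltn_trans (size_scale_leq _ _)) ?size_polyX //.
by rewrite (leq_ltn_trans (size_polyC_leq1 _)).
Qed.

Lemma conj_factor_dvd p z : Im z != 0 -> (cpoly p).[z] = 0 ->
  exists q, p = conj_factor (complex.Re z) (Im z) * q.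
Proof.
case: z => u v /= v0 pz; set Q := conj_factor u v.
have szQ := size_conj_factor u v; rewrite -/Q in szQ.
have Q0 : Q != 0 by rewrite -size_poly_eq0 szQ.
have Qz : (cpoly Q).[u +i* v] = 0.
  rewrite /Q /conj_factor rmorphD rmorphB /= map_polyZ map_polyXn map_polyX.
  rewrite map_polyC !(hornerD, hornerN, hornerZ, hornerXn, hornerX, hornerC).
  rewrite expr2; apply/eqP; rewrite eq_complex /=.
  by apply/andP; split; apply/eqP; ring.
have := divp_eq p Q; have : (size (p %% Q)%R < 3)%N by rewrite -szQ ltn_modp.
move: (p %/ Q) (p %% Q) => q r szr pE.
exists q; suff r0 : r = 0 by rewrite pE r0 addr0 mulrC.
move: pz; rewrite pE rmorphD rmorphM /= hornerD hornerM Qz mulr0 add0r.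
have rE : r = (r`_1) *: 'X + (r`_0)%:P.
  apply/polyP => i; rewrite coefD coefZ coefX coefC.
  case: i => [|[|i]] /=; rewrite ?mulr0 ?mulr1 ?add0r ?addr0 //.
  by rewrite nth_default //; apply: leq_trans (szr : (size r <= 2)%N) _.
rewrite {1}rE rmorphD /= map_polyZ map_polyX map_polyC.
rewrite hornerD hornerZ hornerX hornerC /=.
move/eqP; rewrite eq_complex /= => /andP[/eqP Re0 /eqP Im0].
have r1 : r`_1 = 0.
  by apply: (mulIf v0); move: Im0; rewrite mul0r; lra.
have r0 : r`_0 = 0 by move: Re0; rewrite r1; lra.
by rewrite rE r1 r0 scale0r add0r.
Qed.

(** The condition on the coefficient says that A / B grows at least like X at
    infinity.  Were z = u + iv a zero of A - X B, the cofactor H of the conjugate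
    factor would have H(b) of the sign of A(b) at each root b of B, because the
    conjugate factor is positive on the real line; the interpolation argument
    then kills H. *)
Lemma pick_quotient_sub_mulX_uniq (bs : seq R) A
    (B := \prod_(b <- bs) ('X - b%:P)) :
  uniq bs -> pick_quotient A B -> (size A <= (size bs).+2)%N ->
  0 <= (A - 'X * B)`_(size bs).+1 -> no_nonreal_zeros (A - 'X * B).
Proof.
move=> bs_uniq AB szA lead_ge0.
have szB : size B = (size bs).+1 by rewrite size_prod_XsubC.
set C := A - 'X * B.
have szC : (size C <= (size bs).+2)%N.
  rewrite (leq_trans (size_polyD _ _)) // geq_max szA size_polyN.
  by rewrite (leq_trans (size_polyMleq _ _)) // size_polyX szB.
have CE b : b \in bs -> C.[b] = A.[b].
  move=> b_bs; rewrite !(hornerD, hornerN, hornerM).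
  have /eqP -> : B.[b] == 0 by rewrite -rootE root_prod_XsubC.
  by rewrite mulr0 subr0.
have [C0|C_n0] := eqVneq C 0; first by left.
apply/real_rootedP; right=> z z_gt0; apply: contraNneq C_n0 => Cz.
have [H CH] := conj_factor_dvd C z (lt0r_neq0 z_gt0) Cz.
move: CH; case: z z_gt0 {Cz} => u v /= v0 CH.
suff H_0 : H = 0 by rewrite CH H_0 mulr0.
have Q_n0 : conj_factor u v != 0 by rewrite -size_poly_eq0 size_conj_factor.
have szH : (size H <= size bs)%N.
  have [->|H0] := eqVneq H 0; first by rewrite size_poly0.
  by rewrite -2!ltnS; move: szC; rewrite CH size_mul // size_conj_factor.
apply: (interpolation_le0_eq0 bs H bs_uniq szH) => [b b_bs|].
  have : C.[b] * B^`().[b] <= 0.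
    rewrite CE //; have BE : B = ('X - b%:P) * \prod_(c <- rem b bs) ('X - c%:P).
      exact: big_rem.
    move: AB; rewrite BE => /pick_quotient_simple_root; congr (_ * _ <= 0).
    rewrite derivM derivXsubC hornerD !hornerM hornerXsubC hornerC subrr.
    by rewrite mul0r addr0 mul1r.
  have Qb : 0 < (conj_factor u v).[b].
    rewrite /conj_factor hornerD hornerD hornerN hornerZ hornerXn hornerX hornerC.
    have v2 : 0 < v ^+ 2 by rewrite exprn_gt0.
    have := sqr_ge0 (b - u); nra.
  by rewrite CH hornerM -mulrA pmulr_rle0.
(* The conjugate factor is monic of degree 2, so H has the same leading
   coefficient as C. *)
move: lead_ge0; rewrite -/C CH mulrDl mulrBl coefD coefB coefXnM -scalerAl.
rewrite coefZ coefXM coefCM /=.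
case: (size bs) szH => [|k] szH /=.
  by move: szH; rewrite leqn0 size_poly_eq0 => /eqP->; rewrite coef0.
rewrite subSS subn1 /= [H`_k.+1]nth_default // [H`_k.+2]nth_default 1?ltnW //.
by rewrite !mulr0 subr0 addr0.
Qed.

(** A multiple root b of B is also a root of A; dividing both by X - b lowers the
    number of roots and preserves every hypothesis. *)
Lemma pick_quotient_sub_mulX (bs : seq R) A
    (B := \prod_(b <- bs) ('X - b%:P)) :
  pick_quotient A B -> (size A <= (size bs).+2)%N ->
  0 <= (A - 'X * B)`_(size bs).+1 ->
  no_nonreal_zeros (A - 'X * B).
Proof.
rewrite /B {B}; have [n] := ubnP (size bs).
elim: n bs A => // n IH bs A; rewrite ltnS => szbs AB szA lead_ge0.
have [/hasP[b b_bs b_mult]|/hasPn bs_simple] :=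
  boolP (has (fun b => 1 < count_mem b bs)%N bs); last first.
  apply: pick_quotient_sub_mulX_uniq => //; apply: count_mem_uniq => b.
  have [b_bs|/count_memPn//] := boolP (b \in bs).
  by apply/eqP; rewrite eqn_leq leqNgt bs_simple //= -has_count has_pred1.
have Ab : A.[b] = 0.
  pose B2 := \prod_(c <- bs | c != b) ('X - c%:P).
  apply: (@pick_quotient_multiple_root A B2 b _ b_mult).
    move: AB; rewrite (bigID (pred1 b)) /=; congr (pick_quotient _ (_ * _)).
    rewrite (eq_bigr (fun=> 'X - b%:P)) => [|c /eqP-> //].
    by rewrite big_const_seq iter_mulr_1.
  by rewrite /B2 -big_filter -rootE root_prod_XsubC mem_filter eqxx.
have /factor_theorem [A1 AE] : root A b by rewrite rootE Ab.
have BE := big_rem b b_bs : \prod_(c <- bs) ('X - c%:P) = _; rewrite /= in BE.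
move: AB lead_ge0; rewrite BE AE [A1 * _]mulrC [_ * (_ * _)]mulrCA -mulrBr.
have szbsE : size bs = (size (rem b bs)).+1.
  by rewrite size_rem // prednK //; case: (bs) b_bs.
move=> /pick_quotient_mulXsubC AB1 lead_ge0.
have szA1 : (size A1 <= (size (rem b bs)).+2)%N.
  have [->|A1_0] := eqVneq A1 0; first by rewrite size_poly0.
  by move: szA; rewrite AE size_mul ?polyXsubC_eq0 // size_XsubC addn2 szbsE.
apply: real_rooted_mul; first exact: real_rooted_XsubC.
apply: IH => //; first by rewrite -szbsE.
move: lead_ge0; set C := A1 - _; rewrite mulrBl coefB coefXM coefCM szbsE /=.
rewrite [C`_(size _).+2]nth_default ?mulr0 ?subr0 //.
rewrite (leq_trans (size_polyD _ _)) // geq_max szA1 size_polyN.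
by rewrite (leq_trans (size_polyMleq _ _)) // size_polyX size_prod_XsubC.
Qed.

(** * From a real-rooted pencil to multiplication by the variable *)

(** Either A - X B has no zero in the upper half-plane, or a zero z there gives
    A(z) / B(z) = z, which shows that A / B maps the upper half-plane into itself
    and not into the lower one.  The coefficient condition makes all members of
    the pencil nonzero, so that each of them really is free of zeros in the upper half-plane. *)
Lemma pencil_sub_mulX A B :
  B != 0 -> no_nonreal_zeros B -> (forall a : R, no_nonreal_zeros (A - a *: B)) ->
  (size A <= (size B).+1)%N -> 0 <= lead_coef B * (A - 'X * B)`_(size B) ->
  no_nonreal_zeros (A - 'X * B).
Proof.
move=> B0 B_nnz AB_nnz szA lead_ge0.
set c := lead_coef B in lead_ge0.
have c0 : c != 0 by rewrite lead_coef_eq0.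
have szB : size B = (size B).-1.+1 by rewrite prednK // size_poly_gt0.
have A_lead : A`_(size B) != 0.
  apply: contraTneq lead_ge0; rewrite coefB => ->.
  rewrite szB coefXM /= -lead_coefE -/c sub0r mulrN oppr_ge0 -ltNge.
  by rewrite -expr2 exprn_even_gt0.
have A_neq a : A - a *: B != 0.
  apply: contraNneq A_lead => AB0.
  by rewrite -[A](subrK (a *: B)) AB0 add0r coefZ nth_default // mulr0.
have B_n0 z : 0 < Im z -> (cpoly B).[z] != 0.
  by case/real_rootedP: B_nnz => [/eqP|]; [rewrite (negPf B0) | apply].
have Im_n0 z : 0 < Im z -> Im ((cpoly A).[z] * conjc (cpoly B).[z]) != 0.
  move=> z0; have := B_n0 z z0.
  have AB a : (cpoly A).[z] - a%:C * (cpoly B).[z] != 0.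
    case/real_rootedP: (AB_nnz a) => [/eqP|/(_ z z0)].
      by rewrite (negPf (A_neq a)).
    by rewrite rmorphB /= map_polyZ hornerD hornerN hornerZ.
  move: ((cpoly A).[z]) ((cpoly B).[z]) AB => [a1 a2] [b1 b2] AB.
  rewrite eq_complex /= => b_n0; apply/negP => /eqP ab0.
  have b2_n0 : b1 ^+ 2 + b2 ^+ 2 != 0.
    by rewrite paddr_eq0 ?sqr_ge0 // !sqrf_eq0.
  (* A real value of A / B at z would be the real part of A / B. *)
  have /negP[] := AB ((a1 * b1 + a2 * b2) / (b1 ^+ 2 + b2 ^+ 2)).
  rewrite eq_complex /= !mul0r subr0 addr0; apply/andP.
  have ab : a2 * b1 = a1 * b2 by move: ab0; lra.
  split; apply/eqP; apply: (mulIf b2_n0);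
    rewrite mul0r mulrBl [X in _ - X]mulrAC divfK //.
    by have := congr1 ( *%R b2) ab; nra.
  by have := congr1 ( *%R b1) ab; nra.
have [->|C_n0] := eqVneq (A - 'X * B) 0; first by left.
have [bs BE] := real_rooted_factor B B0 B_nnz; rewrite -/c in BE.
apply/real_rootedP; right=> z z0; apply/negP => Cz.
have AB : pick_quotient A B.
  apply: (pick_quotient_sign A B z Im_n0 z0); move: Cz.
  rewrite rmorphB rmorphM /= map_polyX hornerD hornerN hornerM hornerX.
  rewrite subr_eq0 => /eqP->.
  have := B_n0 z z0; move: ((cpoly B).[z]) => [b1 b2].
  rewrite eq_complex /= => b_n0; case: (z) z0 => x y /= y0.
  suff : 0 < y * (b1 ^+ 2 + b2 ^+ 2) by congr (0 < _); ring.
  rewrite mulr_gt0 // lt0r paddr_eq0 ?sqr_ge0 // !sqrf_eq0 b_n0.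
  by rewrite addr_ge0 ?sqr_ge0.
set B1 := \prod_(_ <- _) _ in BE.
have szB1 : size B = (size bs).+1 by rewrite BE size_scale // size_prod_XsubC.
have AE : A = c *: (c^-1 *: A) by rewrite scalerA divff // scale1r.
have CE : A - 'X * B = c *: (c^-1 *: A - 'X * B1).
  by rewrite scalerBr -AE BE scalerAr.
have AB1 : pick_quotient (c^-1 *: A) B1.
  move=> w /AB; rewrite {1}AE BE ![cpoly (c *: _)]map_polyZ !hornerZ.
  move: ((cpoly _).[w]) ((cpoly B1).[w]) => [a1 a2] [b1 b2] /=.
  have c2 : 0 < c ^+ 2 by rewrite exprn_even_gt0.
  by rewrite -[in X in _ -> X](pmulr_rgt0 _ c2); congr (0 < _); ring.
have : no_nonreal_zeros (c^-1 *: A - 'X * B1).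
  apply: pick_quotient_sub_mulX => //.
    by rewrite size_scale ?invr_eq0 // -szB1.
  move: lead_ge0; rewrite CE coefZ mulrA -expr2 pmulr_rge0 -?szB1 //.
  by rewrite exprn_even_gt0.
have c_nnz : no_nonreal_zeros (c%:P).
  by right=> w; rewrite map_polyC rootC fmorph_eq0 (negPf c0).
move=> /(real_rooted_mul _ _ c_nnz); rewrite mul_polyC -CE.
move=> /real_rootedP [/eqP|/(_ z z0)].
  by rewrite (negPf C_n0).
by rewrite Cz.
Qed.

(** * The operator attached to the partial sums *)

Lemma real_rooted_derivn n p : no_nonreal_zeros p -> no_nonreal_zeros p^`(n).
Proof. by elim: n => // n IH /IH; rewrite derivnS; apply: real_rooted_deriv. Qed.

Lemma real_rooted_Xn n : no_nonreal_zeros ('X^n : {poly R}).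
Proof.
elim: n => [|n IH]; first by rewrite expr0; apply: real_rooted1.
rewrite exprS; apply: real_rooted_mul => //.
by have := real_rooted_XsubC 0; rewrite polyC0 subr0.
Qed.

Lemma rising_factE k l : rising_fact (k%:R + 1) l = ((l + k) ^_ l)%:R :> R.
Proof.
elim: l => [|l IH]; rewrite /rising_fact ?big_ord0 ?ffactn0 // big_ord_recr /=.
rewrite -/(rising_fact _ l) IH addSn ffactSS natrM -[(l + k).+1%:R]natr1 natrD.
rewrite mulrC.
by congr (_ * _); ring.
Qed.

(** Differentiating l times multiplies the coefficient that lands in degree i by
    (i+1)_l, which is exactly the denominator of the multiplier. *)
Lemma coef_diag_rising (S : nat -> R) l p i :
  (diag_op (fun k => S k / rising_fact (k%:R + 1) l) p^`(l))`_i = S i * p`_(l + i).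
Proof.
rewrite coef_diag_op coef_derivn rising_factE -[X in _ * X]mulr_natr mulrA mulrAC.
rewrite divfK //.
by rewrite pnatr_eq0 -lt0n ffact_gt0 leq_addr.
Qed.

End RealRootedPencils.

Theorem corollary16 (R : realType) (m : nat) (p : {poly R})
    (deg_p : size p = m.+1) (p_ge0 : forall j : nat, 0 <= p`_j)
    (l : nat) (l_bounds : (1 <= l <= m.+1)%N) :
  multiplier_sequence
    (fun k : nat => partial_sum p k / rising_fact (k%:R + 1) l) ->
  multiplier_sequence (shift_seq (l - 1) (fun k : nat => p.[k%:R])).
Proof.
case: l l_bounds => // l _ gamma_ms q q_nnz; rewrite subn1 /=.
pose W r :=
  diag_op (fun k => partial_sum p k / rising_fact (k%:R + 1) l.+1) r^`(l.+1).
have W_nnz r : no_nonreal_zeros r -> no_nonreal_zeros (W r).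
  by move=> /(real_rooted_derivn _ l.+1) /gamma_ms.
have X_nnz : no_nonreal_zeros ('X : {poly R}) by have := real_rooted_Xn R 1.
have p_nat_ge0 j : 0 <= p.[j%:R].
  by rewrite horner_coef sumr_ge0 // => i _; rewrite mulr_ge0 ?exprn_ge0.
have S_ge0 k : 0 <= partial_sum p k by apply: sumr_ge0.
have SS k : partial_sum p k.+1 = partial_sum p k + p.[k.+1%:R].
  by rewrite /partial_sum big_ord_recr.
have S_mono : {homo partial_sum p : i j / (i <= j)%N >-> i <= j}.
  by apply: homo_leq => [//|? ? ?|k]; [apply: le_trans | rewrite SS lerDl].
have Wq i : (W q)`_i = partial_sum p i * q`_(l + i).+1.
  by rewrite coef_diag_rising addSn.
have WXq i : (W ('X * q))`_i = partial_sum p i * q`_(l + i).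
  by rewrite coef_diag_rising addSn coefXM.
have CE i : (W ('X * q) - 'X * W q)`_i = p.[i%:R] * q`_(l + i).
  rewrite coefB WXq coefXM; case: i => [|i] /=.
    by rewrite subr0 /partial_sum big_ord1.
  by rewrite Wq addnS SS; ring.
have -> : diag_op (shift_seq l (fun k => p.[k%:R])) q =
    'X^l * (W ('X * q) - 'X * W q).
  apply/polyP => i; rewrite coef_diag_op coefXnM /shift_seq.
  by case: ltnP => [_|/subnKC li]; rewrite ?mul0r // CE li.
apply: real_rooted_mul; first exact: real_rooted_Xn.
have [->|B0] := eqVneq (W q) 0.
  by rewrite mulr0 subr0; apply/W_nnz/real_rooted_mul.
have szB : size (W q) = (size (W q)).-1.+1 by rewrite prednK // size_poly_gt0.
apply: pencil_sub_mulX => // [|a||]; first exact: W_nnz.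
- have -> : W ('X * q) - a *: W q = W (('X - a%:P) * q).
    rewrite /W mulrBl mul_polyC derivnB derivnZ.
    by rewrite [RHS]linearB /= [in RHS]linearZ.
  by apply/W_nnz/real_rooted_mul => //; apply: real_rooted_XsubC.
- apply/leq_sizeP => -[//|i] szBi; have : (W q)`_i = 0 by rewrite nth_default.
  rewrite WXq Wq addnS => /eqP; rewrite mulf_eq0 => /orP[/eqP Si|/eqP->];
    last by rewrite mulr0.
  (* S is nondecreasing and positive at the degree of W q. *)
  have : partial_sum p (size (W q)).-1 != 0.
    by apply: contraNneq B0 => S0; rewrite -lead_coef_eq0 lead_coefE Wq S0 mul0r.
  case/negP; rewrite eq_le S_ge0 andbT -Si S_mono //.
  exact: leq_trans (leq_pred _) (szBi : (size (W q) <= i)%N).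
- rewrite lead_coefE Wq CE; case: (size (W q)) szB => // n _.
  rewrite addnS mulrACA.
  by apply: mulr_ge0; [apply: mulr_ge0 | rewrite -expr2 sqr_ge0].
Qed.
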